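(* Suppose that $\alpha_n$ grows at a strictly faster rate than $n$, i.e. $n/\alpha_n\to0$. Then, under the assumptions listed in the context, for every $y$ with $|y|\le a$, $$E_0^n\left[E\big(\hat f_{EW}(y\mid\Theta_n,\sigma)\,\big|\,\boldsymbol Y_n\big)\right]\longrightarrow\int\frac{\varphi(\theta,k)}{k\sqrt{2\pi}}e^{-\frac{(y-\theta)^2}{2k^2}}\,dG_0(\theta)\qquad(n\to\infty).$$
   Context: Notation. $\phi,\Phi$ are the standard normal density and distribution function; $\mathbb I$ is the indicator. Fixed constants: $a,c,k>0$. For $\theta\in\mathbb R$, $s>0$: $\varphi(\theta,s)=\left[\Phi\left(\frac{a-\theta}{s}\right)-\Phi\left(\frac{-a-\theta}{s}\right)\right]^{-1}$. True density. $f_0(y)=\int_{-a-c}^{a+c}\frac{\varphi(\theta,k)}{k}\phi\left(\frac{y-\theta}{k}\right)\mathbb I_{\{|y|\le a\}}dF_0(\theta)$, where $F_0$ is a probability distribution supported on $[-a-c,a+c]$. For each $n$ the data $\boldsymbol Y_n=(Y_1,\dots,Y_n)$ (the $n$-th row of a triangular array with independent entries) are i.i.d. with density $f_0$; $E_0^n$ is expectation over $\boldsymbol Y_n$ under $f_0$. Bandwidth estimator. $\hat k_n$ is a function of the $n$ data points with $\hat k_n\to k$ almost surely; there is $\eta>0$ with $\hat k_n>\eta$ for all $n\ge1$ almost surely; $(\hat k_n-k)^2$ is uniformly integrable under $f_0$. Priors. $G_0$ is a probability measure on $\mathbb R$ with compact support $\mathbb S\supset[-a-c,a+c]\cup[-2a,2a]$.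 $\alpha_n>0$. $\sigma\sim G_n$, where $G_n(s)=G(s/\sigma_n)$ for a fixed distribution $G$ on $(0,\infty)$ and constants $\sigma_n>0$, $\sigma_n\to0$. There are $\epsilon_n\in(0,1)$, $\epsilon_n\to 0$, with $P(\sigma>\sigma_n)=O(\epsilon_n)$, and $b_n$ with $0<b_n<\sigma_n$, $\sigma_n/b_n\to1$ and $P(\sigma>\sigma_n)/P(b_n<\sigma\le\sigma_n)=O\left(\frac{\epsilon_n}{1-\epsilon_n}\right)$ (probabilities under the prior $G_n$). EW model. $Y_i\mid\theta_i,\sigma\sim N(\theta_i,\sigma^2)$ independently, $\theta_1,\dots,\theta_n\mid F$ i.i.d. $F$, $F\sim DP(\alpha_nG_0)$ (Dirichlet process), independent of $\sigma$. Marginalizing $F$, $\Theta_n=(\theta_1,\dots,\theta_n)$ has the Polya urn law $H_n$: $\theta_1\sim G_0$, $\theta_i\mid\theta_1,\dots,\theta_{i-1}\sim\frac{\alpha_n}{\alpha_n+i-1}G_0+\frac1{\alpha_n+i-1}\sum_{j<i}\delta_{\theta_j}$. The posterior of $(\Theta_n,\sigma)$ given $\boldsymbol Y_n$ is proportional to $\prod_{i=1}^n\frac1\sigma\phi\left(\frac{Y_i-\theta_i}{\sigma}\right)dH_n(\Theta_n)dG_n(\sigma)$; $E(\cdot\mid\boldsymbol Y_n)$ denotes expectation under it. Density estimator. $\hat f_{EW}(y\mid\Theta_n,\sigma)=\frac{\alpha_n}{\alpha_n+n}A_n(y)+\frac1{\alpha_n+n}\sum_{i=1}^n\frac{\varphi(\theta_i,\sigma+\hat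 k_n)}{\sigma+\hat k_n}\phi\left(\frac{y-\theta_i}{\sigma+\hat k_n}\right)\mathbb I_{\{|y|\le a\}}$, with $A_n(y)=\int\frac{\varphi(\theta,\sigma+\hat k_n)}{\sigma+\hat k_n}\phi\left(\frac{y-\theta}{\sigma+\hat k_n}\right)\mathbb I_{\{|y|\le a\}}dG_0(\theta)$. *)

(* Defs.v *)
From HB Require Import structures.
From mathcomp Require Import all_boot all_order all_algebra.
From mathcomp Require Import all_classical all_reals all_analysis.
From mathcomp Require Import measurable_realfun.

Set Implicit Arguments.
Unset Strict Implicit.
Unset Printing Implicit Defensive.

Import Order.TTheory GRing.Theory Num.Theory.
Import numFieldNormedType.Exports.

Local Open Scope classical_set_scope.
Local Open Scope ring_scope.

Section generic_probability.
Context {d : measure_display} {T : measurableType d} {R : realType}.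

Definition mutually_independent (P : probability T R) (I : finType)
    (X : I -> {RV P >-> R}) : Prop :=
  forall (J : {set I}) (B : I -> set R), (forall i, measurable (B i)) ->
    P [set w | forall i, i \in J -> B i (X i w)] =
    (\prod_(i in J) P (X i @^-1` B i))%E.

Definition has_density (P : probability T R) (X : {RV P >-> R}) (f : R -> R) :
  Prop :=
  forall B : set R, measurable B ->
    distribution P X B = (\int[lebesgue_measure]_(x in B) (f x)%:E)%E.

Definition uniformly_integrable (P : probability T R) (X : nat -> T -> R) :
  Prop :=
  ereal_sup [set (\int[P]_(w in [set w | (M < `|X n w|)%R]) `|X n w|%:E)%E |
             n in [set: nat]] @[M --> +oo] --> 0%E.

Definition sample (P : probability T R)
    (Y : forall n : nat, 'I_n -> {RV P >-> R}) (n : nat) (w : T) : n.-tuple R :=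
  [tuple Y n i w | i < n].

End generic_probability.

Definition topological_support (R : realType) (mu : probability R R) : set R :=
  [set x | forall U, open U -> U x -> (0 < mu U)%E].

Section density_measure.
Context {d : measure_display} {T : measurableType d} {R : realType}.
Variables (mu : {measure set T -> \bar R}) (f : T -> R).
Variables (f_ge0 : forall x, 0 <= f x) (mf : measurable_fun [set: T] f).

Definition density_measure of (forall x, 0 <= f x) & measurable_fun [set: T] f
  : set T -> \bar R := fun B => (\int[mu]_(x in B) (f x)%:E)%E.

Local Notation nu := (density_measure f_ge0 mf).

Let nu0 : nu set0 = 0%E.
Proof. by rewrite /density_measure integral_set0. Qed.

Let nu_ge0 B : (0 <= nu B)%E.
Proof. by apply: integral_ge0 => x _; rewrite lee_fin. Qed.

Let nu_sigma_additive : semi_sigma_additive nu.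
Proof.
move=> F mF tF mUF; rewrite /density_measure.
rewrite [X in _ --> X](_ : _ =
    (\sum_(0 <= i <oo) \int[mu]_(x in F i) (f x)%:E)%E); last first.
  rewrite ge0_integral_bigcup//.
    by apply/measurable_EFinP; exact: measurable_funTS.
  by move=> x _; rewrite lee_fin.
by apply: is_cvg_ereal_nneg_natsum_cond => n _ _; exact: nu_ge0.
Qed.

HB.instance Definition _ := isMeasure.Build _ _ _ nu
  nu0 nu_ge0 nu_sigma_additive.

End density_measure.

Section kernel_product.
Context {d1 d2 : measure_display} {T1 : measurableType d1}
  {T2 : measurableType d2} {R : realType}.
Variables (mu : probability T1 R) (k : R.-pker T1 ~> T2).

Definition kernel_product : set (T1 * T2)%type -> \bar R :=
  fun A => (\int[mu]_x k x (xsection A x))%E.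

Let kernel_product0 : kernel_product set0 = 0%E.
Proof.
rewrite /kernel_product integral0_eq// => x _.
by rewrite xsection0 measure0.
Qed.

Let kernel_product_ge0 A : (0 <= kernel_product A)%E.
Proof. exact: integral_ge0. Qed.

Let kernel_product_sigma_additive : semi_sigma_additive kernel_product.
Proof.
move=> F mF tF mUF; rewrite /kernel_product.
rewrite [X in _ --> X](_ : _ =
    (\sum_(0 <= i <oo) \int[mu]_x k x (xsection (F i) x))%E); last first.
  rewrite -integral_nneseries//; last first.
    by move=> n; apply: measurable_fun_xsection_finite_kernel; rewrite inE.
  apply: eq_integral => x _; rewrite xsection_bigcup measure_bigcup//.
  - by apply: eq_eseriesl => n; rewrite in_setT.
  - by move=> n _; exact: measurable_xsection.
  - exact: trivIset_xsection.
by apply: is_cvg_ereal_nneg_natsum_cond => n _ _; exact: kernel_product_ge0.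
Qed.

HB.instance Definition _ := isMeasure.Build _ _ _ kernel_product
  kernel_product0 kernel_product_ge0 kernel_product_sigma_additive.

Let kernel_product_setT : kernel_product [set: T1 * T2] = 1%E.
Proof.
rewrite /kernel_product.
under eq_integral => x _.
  rewrite (_ : xsection _ x = setT) ?prob_kernel; last first.
    by apply/seteqP; split=> y // _; rewrite /xsection/= inE.
  over.
by rewrite integral_cst//= mul1e probability_setT.
Qed.

HB.instance Definition _ := Measure_isProbability.Build _ _ _ kernel_product
  kernel_product_setT.

End kernel_product.

Section polya_urn.
Context {R : realType}.
Variables (alpha : {posnum R}) (G0 : probability R R).

(* Law of [theta_(m+1)] given [theta_1, ..., theta_m]: for [m = 0] it is [G0]. *)
Definition polya_predictive (m : nat) (t : m.-tuple R) :
    {measure set R -> \bar R} :=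
  measure_add (mscale (alpha%:num / (alpha%:num + m%:R))%:nng G0)
    (mscale (alpha%:num + m%:R)^-1%:nng
      (msum (fun j => \d_(nth 0 t j) : {measure set R -> \bar R}) m)).

Lemma polya_predictiveE (m : nat) (t : m.-tuple R) (U : set R) :
  polya_predictive t U =
  ((alpha%:num / (alpha%:num + m%:R))%:E * G0 U +
   (alpha%:num + m%:R)^-1%:E * \sum_(j < m) \d_(nth 0%R t j) U)%E.
Proof. exact: measure_addE. Qed.

Let measurable_polya_predictive (m : nat) (U : set R) : measurable U ->
  measurable_fun [set: m.-tuple R] (fun t => polya_predictive t U).
Proof.
move=> mU; under eq_fun do rewrite polya_predictiveE.
apply: emeasurable_funD; first exact: measurable_cst.
apply: measurable_funeM.
apply: emeasurable_sum => j.
apply/measurable_EFinP.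
apply: (measurableT_comp (measurable_indic _)) => //.
under eq_fun do rewrite -tnth_nth.
exact: measurable_tnth.
Qed.

HB.instance Definition _ (m : nat) := isKernel.Build _ _ _ _ _
  (@polya_predictive m) (@measurable_polya_predictive m).

Let polya_predictive_setT (m : nat) (t : m.-tuple R) :
  polya_predictive t [set: R] = 1%E.
Proof.
rewrite polya_predictiveE probability_setT.
under eq_bigr do rewrite diracT.
rewrite mule1 sumEFin sumr_const card_ord -EFinM -EFinD.
by rewrite mulrC -mulrDr mulVf.
Qed.

HB.instance Definition _ (m : nat) := Kernel_isProbability.Build _ _ _ _ _
  (@polya_predictive m) (@polya_predictive_setT m).

Definition tuple_rcons (m : nat) (p : (m.-tuple R * R)%type) : m.+1.-tuple R :=
  [tuple of rcons p.1 p.2].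

Let measurable_tuple_rcons (m : nat) :
  measurable_fun [set: (m.-tuple R * R)%type] (@tuple_rcons m).
Proof.
apply/measurable_fun_tnthP => i.
have [im|im] := ltnP i m.
  rewrite (_ : _ \o _ = (fun p => tnth p.1 (Ordinal im))).
    exact: (measurableT_comp (measurable_tnth _)).
  by apply/funext => p /=; rewrite !(tnth_nth 0)/= nth_rcons size_tuple im.
rewrite (_ : _ \o _ = snd); first exact: measurable_snd.
apply/funext => p /=; rewrite !(tnth_nth 0)/= nth_rcons size_tuple ltnNge im/=.
by rewrite ifT// eqn_leq im -ltnS ltn_ord.
Qed.

HB.instance Definition _ (m : nat) := isMeasurableFun.Build _ _ _ _
  (@tuple_rcons m) (@measurable_tuple_rcons m).

Fixpoint polya_urn (n : nat) : probability (n.-tuple R) R :=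
  match n with
  | 0 => \d_[tuple]
  | m.+1 => distribution (kernel_product (polya_urn m) (@polya_predictive m))
              (@tuple_rcons m)
  end.

End polya_urn.

Section truncated_normal.
Context {R : realType}.
Implicit Types a c k s theta y : R.

Definition std_normal_pdf (x : R) : R := normal_pdf 0 1 x.

Definition std_normal_cdf (x : R) : R :=
  fine (normal_prob 0 1 `]-oo, x]%classic).

Lemma normal_pdf_scale (m s x : R) : 0 < s ->
  normal_pdf m s x = s^-1 * std_normal_pdf ((x - m) / s).
Proof.
move=> s0; rewrite /std_normal_pdf !normal_pdfE ?oner_eq0 ?gt_eqF//.
rewrite mulrA; congr (_ * _).
  rewrite /normal_peak -invfM; congr (_^-1).
  rewrite expr1n mul1r -mulrnAr sqrtrM ?sqr_ge0// sqrtr_sqr gtr0_norm//.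
rewrite /normal_fun subr0 expr1n exprMn exprVn; congr expR.
by rewrite -!mulNr -mulr_natr invfM mulrA.
Qed.

Definition trunc_const a theta s : R :=
  (std_normal_cdf ((a - theta) / s) - std_normal_cdf ((- a - theta) / s))^-1.

Definition trunc_kernel a s theta y : R :=
  trunc_const a theta s / s * std_normal_pdf ((y - theta) / s) *
  (`|y| <= a)%R%:R.

Definition true_density a c k (F0 : probability R R) y : R :=
  \int[F0]_(theta in `[(- a - c), (a + c)]) trunc_kernel a k theta y.

End truncated_normal.

Section escobar_west.
Context {R : realType}.
Variables (n : nat) (Y : n.-tuple R).

(* [p] is the pair of the locations and the bandwidth. By [normal_pdf_scale] a
   factor is [s^-1 * phi ((Y_i - theta_i) / s)] for a bandwidth [s > 0]. *)
Definition ew_likelihood (p : (n.-tuple R * R)%type) : R :=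
  \prod_(i < n) normal_pdf (tnth p.1 i) p.2 (tnth Y i).

Lemma ew_likelihood_ge0 p : 0 <= ew_likelihood p.
Proof. by apply: prodr_ge0 => i _; exact: normal_pdf_ge0. Qed.

Let measurable_inv_ge0 d (T : measurableType d) (f : T -> R) :
  (forall x, 0 <= f x) -> measurable_fun setT f ->
  measurable_fun setT (fun x => (f x)^-1).
Proof.
move=> f0 mf; under eq_fun do rewrite -powR_inv1//.
exact: (measurableT_comp (measurable_powR _)).
Qed.

Lemma measurable_ew_likelihood : measurable_fun setT ew_likelihood.
Proof.
apply: measurable_prod => i _.
have mtheta : measurable_fun setT (fun p : (n.-tuple R * R)%type => tnth p.1 i).
  exact: (measurableT_comp (measurable_tnth _)).
have msigma2 : measurable_fun setT (fun p : (n.-tuple R * R)%type => p.2 ^+ 2).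
  exact: measurable_funX.
rewrite /normal_pdf; apply: measurable_fun_ifT => /=.
- exact: measurable_fun_eqr.
- exact: measurable_cst.
apply: measurable_funM.
  apply: measurable_inv_ge0 => [p|]; first exact: sqrtr_ge0.
  apply: measurableT_comp; first by apply: continuous_measurable_fun; exact: sqrt_continuous.
  under eq_fun do rewrite -mulr_natr.
  by apply: measurable_funM => //; exact: measurable_funM.
apply: measurableT_comp => //; apply: measurable_funM.
  apply: measurableT_comp => //; apply: measurable_funX.
  exact: measurable_funB.
apply: measurable_inv_ge0 => [p|]; first by rewrite mulrn_wge0// sqr_ge0.
under eq_fun do rewrite -mulr_natr.
exact: measurable_funM.
Qed.

End escobar_west.

Section escobar_west_posterior.
Context {R : realType}.
Variables (alpha : {posnum R}) (G0 : probability R R).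
Variables (Gsigma : probability R R).

Section prior.
Variable n : nat.

Definition ew_prior : set (n.-tuple R * R)%type -> \bar R :=
  (polya_urn alpha G0 n \x Gsigma)%E.

HB.instance Definition _ := Measure.on ew_prior.

Let ew_prior_setT : ew_prior [set: n.-tuple R * R] = 1%E.
Proof.
rewrite -setXTT /ew_prior product_measure1E//.
by rewrite -[RHS]mule1; congr (_ * _)%E; exact: probability_setT.
Qed.

HB.instance Definition _ := Measure_isProbability.Build _ _ _ ew_prior
  ew_prior_setT.

End prior.

(* [mnormalize] falls back on its second argument when the total mass is 0 or
   +oo. The mass is positive, and it is finite for Lebesgue-almost every [Y], so
   the fallback does not affect an expectation over data with a density. *)
Definition ew_posterior (n : nat) (Y : n.-tuple R) :
    probability (n.-tuple R * R)%type R :=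
  mnormalize
    (density_measure (@ew_prior n) (ew_likelihood_ge0 Y)
      (measurable_ew_likelihood Y))
    (@ew_prior n).

Definition ew_density (n : nat) (a khat y : R) (p : (n.-tuple R * R)%type) :
    R :=
  alpha%:num / (alpha%:num + n%:R) *
    (\int[G0]_theta trunc_kernel a (p.2 + khat) theta y) +
  (alpha%:num + n%:R)^-1 *
    \sum_(i < n) trunc_kernel a (p.2 + khat) (tnth p.1 i) y.

End escobar_west_posterior.

(* Main.v *)
(** The prior of [sigma] is a scale family, so the mass it gives to values above
    [sigma n] does not depend on [n]; being [O(eps n)] with [eps n -> 0], it
    vanishes. The posterior is absolutely continuous with respect to the prior,
    so that, whatever the data, [sigma] lies in [(0, sigma n]] and all the
    [theta_i] lie in a fixed interval [[-M, M]] with posterior probability one.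
    There the truncated kernels with bandwidth at least [eta] are uniformly
    bounded, so the urn part of the density estimator is [O(n / alpha n)], and
    its [G0] part is the mixture of truncated kernels at a bandwidth within
    [sigma n] of [khat n]. The mixture is continuous at [k] by dominated
    convergence, and [khat n] tends to [k] in probability. *)

Require Import Defs.
From HB Require Import structures.
From mathcomp Require Import all_boot all_order all_algebra.
From mathcomp Require Import all_classical all_reals all_analysis.
From mathcomp Require Import measurable_realfun ring lra.

Set Implicit Arguments.
Unset Strict Implicit.
Unset Printing Implicit Defensive.

Import Order.TTheory GRing.Theory Num.Theory.
Import numFieldNormedType.Exports.

Local Open Scope classical_set_scope.
Local Open Scope ring_scope.

(** * Bounds on integrals off an exceptional set *)

(* No integrand is assumed measurable here, the integral of a nonnegative
   function being a supremum over simple functions: the measurability of the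
   posterior mean as a function of the data is never needed. *)
Section nonmeasurable_integrands.
Context {d : measure_display} {T : measurableType d} {R : realType}.
Local Open Scope ereal_scope.

Lemma ge0_le_integralT (mu : {measure set T -> \bar R}) (f g : T -> \bar R) :
  (forall x, 0 <= f x) -> (forall x, f x <= g x) ->
  \int[mu]_x f x <= \int[mu]_x g x.
Proof.
move=> f0 fg; rewrite !ge0_integralTE//; last first.
  by move=> x; exact: le_trans (fg x).
apply: ereal_sup_le => _ [h /= hf <-].
by exists h => // x; exact: le_trans (fg x).
Qed.

(** For [lo > 0] the integrand dominates [lo] times the indicator of the complement of [E];
    otherwise the left side is nonpositive. *)
Lemma integral_ge_off (P : probability T R) (f : T -> \bar R) (E : set T)
    (lo : R) :
  measurable E -> (forall x, 0 <= f x) ->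
  (forall x, ~ E x -> lo%:E <= f x) ->
  (lo * (1 - fine (P E)))%:E <= \int[P]_x f x.
Proof.
move=> mE f0 flo.
have PEfin : P E \is a fin_num by exact: fin_num_measure.
have PE1 : (fine (P E) <= 1)%R by rewrite -lee_fin fineK// probability_le1.
have [lo0|lo0] := leP lo 0%R.
  apply: (@le_trans _ _ 0); last exact: integral_ge0.
  by rewrite lee_fin mulr_le0_ge0// subr_ge0.
apply: (@le_trans _ _ (\int[P]_x (lo%:E * (\1_(~` E) x)%:E))).
  rewrite ge0_integralZl//; last 2 first.
  - by apply/measurable_EFinP; apply: measurable_indic; exact: measurableC.
  - exact: ltW.
  rewrite integral_indic//; last exact: measurableC.
  rewrite setIT (_ : _ (~` E) = 1 - P E); last exact: probability_setC.
  by rewrite EFinM EFinB fineK.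
apply: ge0_le_integralT => x.
  by rewrite mule_ge0// lee_fin// ltW.
rewrite indicE; case: (asboolP ((~` E) x)) => Ex.
  by rewrite mem_set// mule1; exact: flo.
by rewrite memNset// mule0.
Qed.

(** The integrand is dominated everywhere by [hi + C * \1_E + +oo * \1_N], a measurable function
    whose last term integrates to 0. *)
Lemma integral_le_off (P : probability T R) (f : T -> \bar R) (E N : set T)
    (hi C : R) :
  measurable E -> measurable N -> P N = 0 ->
  (0 <= hi)%R -> (0 <= C)%R -> (forall x, 0 <= f x) ->
  (forall x, ~ N x -> ~ E x -> f x <= hi%:E) ->
  (forall x, ~ N x -> f x <= C%:E) ->
  \int[P]_x f x <= (hi + C * fine (P E))%:E.
Proof.
move=> mE mN PN0 hi0 C0 f0 fhi fC.
have PEfin : P E \is a fin_num by exact: fin_num_measure.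
pose g x := hi%:E + C%:E * (\1_E x)%:E.
pose h x := +oo * (\1_N x)%:E : \bar R.
have g0 x : 0 <= g x by rewrite adde_ge0// mule_ge0// lee_fin.
have h0 x : 0 <= h x by rewrite mule_ge0// lee_fin.
apply: (@le_trans _ _ (\int[P]_x (g x + h x))).
  apply: ge0_le_integralT => // x; rewrite /g /h !indicE.
  case: (asboolP (N x)) => Nx.
    by rewrite (mem_set Nx) mule1 -EFinM -EFinD addey ?leey.
  rewrite (memNset Nx) mule0 adde0.
  case: (asboolP (E x)) => Ex.
    by rewrite (mem_set Ex) mule1 -EFinD (le_trans (fC _ Nx))// lee_fin lerDr.
  by rewrite (memNset Ex) mule0 adde0 fhi.
have mi A : measurable A -> measurable_fun [set: T] (fun x => (\1_A x : R)%:E).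
  by move=> mA; apply/measurable_EFinP; exact: measurable_indic.
rewrite ge0_integralD//; last 2 first.
- by apply: emeasurable_funD => //; apply: measurable_funeM; exact: mi.
- by apply: measurable_funeM; exact: mi.
rewrite [X in _ + X](_ : _ = 0) ?adde0; last first.
  rewrite /h ge0_integralZl//; last exact: mi.
  by rewrite integral_indic// setIT (_ : _ N = 0) ?mule0.
rewrite /g ge0_integralD//; last 2 first.
- by move=> x _; rewrite mule_ge0// lee_fin.
- by apply: measurable_funeM; exact: mi.
rewrite integral_cst// (_ : _ [set: T] = 1) ?mule1; last exact: probability_setT.
rewrite ge0_integralZl//; last exact: mi.
by rewrite integral_indic// setIT EFinD EFinM fineK.
Qed.

End nonmeasurable_integrands.

(** * Nullity outside a bounded interval for a compactly supported law *)

Lemma measurable_norm_gt (R : realType) (M : R) : measurable [set x : R | M < `|x|].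
Proof.
rewrite (_ : [set x : R | M < `|x|] = ~` `[- M, M]%classic).
  exact: measurableC.
by apply/seteqP; split => x /=; rewrite in_itv/= -ler_norml ltNge => /negP.
Qed.

(** A point outside the support has a null neighbourhood, hence lies in a null open interval with
    rational endpoints. There are countably many such intervals, so their union is null. *)
Lemma compact_support_bounded (R : realType) (mu : probability R R) :
  compact (topological_support mu) ->
  exists M : R, mu [set x | M < `|x|] = 0%E.
Proof.
move=> /compact_bounded [M0 [_ bndM]].
pose M := M0 + 1.
have suppM x : topological_support mu x -> `|x| <= M.
  by move=> Sx; apply: bndM => //; rewrite ltrDl.
exists M.
have mM := @measurable_norm_gt R M.
apply: measure_negligible => //.
(* Enumeration of the null intervals with rational endpoints; codes of other intervals, and integers
   that are not codes, give [set0]. *)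
pose F n : set R :=
  if unpickle n is Some pq then
    let I := `](ratr pq.1 : R), ratr (pq.2 : rat)[%classic in
    if mu I == 0%E then I else set0
  else set0.
apply: (@negligibleS _ _ _ _ (\bigcup_n F n)); last first.
  apply: negligible_bigcup => n; rewrite /F.
  case: unpickle => [pq|]; last exact: negligible_set0.
  case: ifPn => [/eqP muI|_]; last exact: negligible_set0.
  exact/negligibleP.
move=> x /= Mx.
have /existsNP[U /not_implyP[oU /not_implyP[Ux muU]]] :
    ~ topological_support mu x by move=> /suppM; rewrite leNgt Mx.
have mU : measurable U by exact: open_measurable.
have {}muU : mu U = 0%E.
  by apply/eqP; rewrite eq_le measure_ge0 andbT leNgt; exact/negP.
have /nbhs_ballP[e /= e0 xeU] : nbhs x U by exact: open_nbhs_nbhs.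
have /rat_in_itvoo[p] : x - e < x by rewrite ltrBlDr ltrDl.
rewrite in_itv/= => /andP[xp px].
have /rat_in_itvoo[q] : x < x + e by rewrite ltrDl.
rewrite in_itv/= => /andP[xq qx].
have muI : mu `](ratr p : R), ratr q[%classic = 0%E.
  apply: (@subset_measure0 _ _ _ mu _ U) => //.
  move=> z /=; rewrite in_itv/= => /andP[pz zq]; apply: xeU.
  rewrite /ball/= ltr_norml; apply/andP; split.
    by rewrite ltrBrDl -ltrBrDr opprK (lt_trans zq)// addrC.
  by rewrite ltrBlDl -ltrBlDr (lt_trans xp).
exists (pickle (p, q)); first exact: I.
by rewrite /F pickleK muI eqxx; apply/andP; split.
Qed.

(** * The truncated normal kernel: sign, uniform bound, continuity *)

Section truncated_normal_kernel.
Context {R : realType}.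
Implicit Types a s theta x y B : R.

Lemma std_normal_pdfE x :
  std_normal_pdf x = normal_peak 1 * expR (- (x ^+ 2 / 2)).
Proof.
rewrite /std_normal_pdf normal_pdfE ?oner_eq0// /normal_fun.
by rewrite subr0 expr1n mulNr.
Qed.

Lemma std_normal_pdf_gt0 x : 0 < std_normal_pdf x.
Proof.
by rewrite std_normal_pdfE mulr_gt0// ?expR_gt0// normal_peak_gt0// oner_eq0.
Qed.

Lemma std_normal_pdf_le_peak x : std_normal_pdf x <= normal_peak 1.
Proof. by apply: normal_pdf_ub; rewrite oner_eq0. Qed.

Lemma std_normal_pdf_anti x B : `|x| <= B -> std_normal_pdf B <= std_normal_pdf x.
Proof.
move=> xB; rewrite !std_normal_pdfE ler_wpM2l ?normal_peak_ge0//.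
rewrite ler_expR lerN2 ler_pM2r ?invr_gt0 ?ltr0n// -(real_normK (num_real x)).
by rewrite ler_pXn2r// nnegrE// (le_trans _ xB).
Qed.

Lemma std_normal_cdfB x y : x <= y ->
  std_normal_cdf y - std_normal_cdf x =
  fine (\int[lebesgue_measure]_(t in `]x, y]) (std_normal_pdf t)%:E)%E.
Proof.
move=> xy; rewrite /std_normal_cdf -fineB; last 2 first.
- exact: fin_num_measure.
- exact: fin_num_measure.
congr fine.
rewrite (_ : `]-oo, y]%classic = `]-oo, x] `|` `]x, y]); last first.
  by rewrite -itv_bndbnd_setU.
rewrite measureU//; last first.
  apply/seteqP; split=> t //= []; rewrite !in_itv/= => tx /andP[].
  by rewrite ltNge tx.
by rewrite addeAC subee ?add0e//; exact: fin_num_measure.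
Qed.

(** On the interval the density lies between its value at [B] and its peak. The lower bound controls
    the normalizing constant of the kernel, the upper one makes the cdf Lipschitz. *)
Lemma std_normal_cdfB_bounds x y B : x <= y ->
  (forall t, x < t <= y -> `|t| <= B) ->
  (y - x) * std_normal_pdf B <= std_normal_cdf y - std_normal_cdf x
    <= (y - x) * normal_peak 1.
Proof.
move=> xy tB; rewrite std_normal_cdfB//.
have mpdf D : measurable_fun D (fun t => (std_normal_pdf t : R)%:E).
  apply/measurable_EFinP; apply: (@measurable_funTS).
  exact: measurable_normal_pdf.
have cstE (r : R) : (\int[lebesgue_measure]_(t in `]x, y]) r%:E =
    ((y - x) * r)%:E)%E.
  rewrite integral_cst//= lebesgue_measure_itv/= lte_fin.
  case: ltP => [//|yx]; first by rewrite -EFinD -EFinM mulrC.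
  by rewrite (le_anti (introT andP (conj xy yx))) subrr mul0r mule0.
set J := (\int[lebesgue_measure]_(t in `]x, y]) (std_normal_pdf t)%:E)%E.
have loJ : (((y - x) * std_normal_pdf B)%:E <= J)%E.
  rewrite -cstE; apply: ge0_le_integral => //=.
  - by move=> ? _; rewrite lee_fin ltW// std_normal_pdf_gt0.
  - exact: mpdf.
  - by move=> t; rewrite in_itv/= lee_fin => /tB; exact: std_normal_pdf_anti.
have Jhi : (J <= ((y - x) * normal_peak 1)%:E)%E.
  rewrite -cstE; apply: ge0_le_integral => //=.
  - by move=> t ?; rewrite lee_fin ltW// std_normal_pdf_gt0.
  - exact: mpdf.
  - by move=> t ?; rewrite lee_fin std_normal_pdf_le_peak.
have Jfin : J \is a fin_num.
  by rewrite fin_numE; move: loJ Jhi; case: J.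
by rewrite -!lee_fin fineK// loJ.
Qed.

Lemma std_normal_cdf_nd x y : x <= y -> std_normal_cdf x <= std_normal_cdf y.
Proof.
move=> xy; rewrite -subr_ge0 std_normal_cdfB// fine_ge0// integral_ge0// => t _.
by rewrite lee_fin ltW// std_normal_pdf_gt0.
Qed.

Lemma norm_le_max_itv x y t : x < t <= y -> `|t| <= Num.max `|x| `|y|.
Proof.
move=> /andP[xt ty]; rewrite le_max; case: (ger0P t) => t0.
  by rewrite (le_trans ty (ler_norm y)) orbT.
by rewrite -(normrN x) (le_trans _ (ler_norm _)) ?lerN2 ?(ltW xt).
Qed.

Lemma std_normal_cdf_lipschitz x y :
  `|std_normal_cdf x - std_normal_cdf y| <= `|x - y| * normal_peak 1.
Proof.
wlog yx : x y / y <= x.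
  move=> H; have [/H//|/ltW/H] := leP y x.
  by rewrite distrC [in X in _ <= X]distrC.
have tB := @norm_le_max_itv y x.
have /andP[_ ub] := std_normal_cdfB_bounds yx tB.
by rewrite !ger0_norm ?subr_ge0// std_normal_cdf_nd.
Qed.

Lemma continuous_std_normal_cdf : continuous (@std_normal_cdf R).
Proof.
have p0 : 0 < normal_peak (1 : R) by rewrite normal_peak_gt0// oner_eq0.
move=> x; apply/cvgrPdist_le => e e0.
exists (e / normal_peak 1) => /=; first by rewrite divr_gt0.
move=> t /= xt; rewrite (le_trans (std_normal_cdf_lipschitz _ _))//.
by rewrite -ler_pdivlMr// ltW.
Qed.

(** For negative [s] the difference of cdf's and [s] are both nonpositive, so their product keeps
    its sign. With no condition on [s], the estimator is nonnegative at every parameter value, as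
    the integral bounds require. *)
Lemma trunc_kernel_ge0 a s theta y : 0 <= a -> 0 <= trunc_kernel a s theta y.
Proof.
move=> a0; rewrite /trunc_kernel /trunc_const mulr_ge0// mulr_ge0//; last first.
  by rewrite ltW// std_normal_pdf_gt0.
have aa : - a - theta <= a - theta by rewrite lerD2r; lra.
rewrite -invfM invr_ge0.
have [s0|s0] := leP 0 s.
  by rewrite mulr_ge0// subr_ge0 std_normal_cdf_nd// ler_wpM2r// invr_ge0.
rewrite mulr_le0 ?(ltW s0)// subr_le0 std_normal_cdf_nd//.
by rewrite ler_wnM2r// invr_le0 ltW.
Qed.

(** [(a + M) / eta] is the largest modulus of [(t - theta) / s] when [|t| <= a], [|theta| <= M] and
    [s >= eta]. *)
Definition trunc_kernel_bound (a M eta : R) :=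
  normal_peak 1 / (2 * a * std_normal_pdf ((a + M) / eta)).

Lemma trunc_kernel_bound_ge0 a M eta : 0 <= a -> 0 <= trunc_kernel_bound a M eta.
Proof.
move=> a0; rewrite /trunc_kernel_bound divr_ge0 ?normal_peak_ge0//.
by rewrite mulr_ge0 ?mulr_ge0// ltW// std_normal_pdf_gt0.
Qed.

Lemma std_normal_cdfB_gt0 a s theta : 0 < a -> 0 < s ->
  std_normal_cdf ((- a - theta) / s) < std_normal_cdf ((a - theta) / s).
Proof.
move=> a0 s0.
have xy : (- a - theta) / s <= (a - theta) / s.
  by rewrite ler_wpM2r ?invr_ge0 ?(ltW s0)//; lra.
have tB := @norm_le_max_itv ((- a - theta) / s) ((a - theta) / s).
have /andP[lb _] := std_normal_cdfB_bounds xy tB.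
rewrite -subr_gt0 (lt_le_trans _ lb)// mulr_gt0 ?std_normal_pdf_gt0//.
by rewrite -mulrBl mulr_gt0 ?invr_gt0//; lra.
Qed.

(* The mean value bound on the normalizing difference of cdf's contributes a
   factor [2 a / s] which cancels the [1 / s] of the kernel. *)
Lemma trunc_kernel_le a M eta s theta y : 0 < a -> 0 < eta -> eta <= s ->
  `|theta| <= M -> trunc_kernel a s theta y <= trunc_kernel_bound a M eta.
Proof.
move=> a0 eta0 etas thM.
have s0 : 0 < s by exact: lt_le_trans etas.
have M0 : 0 <= M by exact: le_trans thM.
have xy : (- a - theta) / s <= (a - theta) / s.
  by rewrite ler_wpM2r ?invr_ge0 ?(ltW s0)//; lra.
have [thM1 thM2] : - M <= theta /\ theta <= M by move: thM; rewrite ler_norml => /andP.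
have aMs : (a + M) / s <= (a + M) / eta.
  by rewrite ler_wpM2l ?lef_pV2 ?posrE// addr_ge0// ltW.
have tB t : (- a - theta) / s < t <= (a - theta) / s -> `|t| <= (a + M) / eta.
  move=> /andP[yt tx]; rewrite (le_trans _ aMs)// ler_norml; apply/andP; split.
    rewrite (le_trans _ (ltW yt))// -mulNr ler_pM2r ?invr_gt0//; lra.
  rewrite (le_trans tx)// ler_pM2r ?invr_gt0//; lra.
have /andP[lb _] := std_normal_cdfB_bounds xy tB.
rewrite /trunc_kernel.
have K0 := trunc_kernel_ge0 s theta y (ltW a0).
apply: (@le_trans _ _ (trunc_const a theta s / s * std_normal_pdf ((y - theta) / s))).
  rewrite ler_piMr//; last by rewrite lern1 leq_b1.
  rewrite mulr_ge0//; last by rewrite ltW// std_normal_pdf_gt0.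
  by rewrite divr_ge0 ?(ltW s0)// invr_ge0 subr_ge0 std_normal_cdf_nd.
rewrite /trunc_const /trunc_kernel_bound -invfM mulrC.
apply: ler_pM => //.
- by rewrite ltW// std_normal_pdf_gt0.
- by rewrite invr_ge0 mulr_ge0 ?(ltW s0)// subr_ge0 std_normal_cdf_nd.
- exact: std_normal_pdf_le_peak.
have pB := std_normal_pdf_gt0 ((a + M) / eta).
rewrite lef_pV2 ?posrE//.
- have -> : 2 * a * std_normal_pdf ((a + M) / eta) = s *
      (((a - theta) / s - (- a - theta) / s) * std_normal_pdf ((a + M) / eta)).
    by field; rewrite gt_eqF.
  by rewrite [in leRHS]mulrC ler_pM2l.
- by rewrite mulr_gt0// subr_gt0 std_normal_cdfB_gt0.
- by rewrite !mulr_gt0.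
Qed.

Lemma continuous_std_normal_pdf : continuous (@std_normal_pdf R).
Proof. by apply: continuous_normal_pdf; rewrite oner_eq0. Qed.

(** Positivity of [a] and [s] keeps every denominator nonzero at the limit. Letting both parameters
    vary gives continuity in the bandwidth and measurability in the location at once. *)
Lemma trunc_kernel_cvg (T : Type) (F : set_system T) (FF : Filter F)
    (f g : T -> R) a s theta y : 0 < a -> 0 < s ->
  f x @[x --> F] --> s -> g x @[x --> F] --> theta ->
  trunc_kernel a (f x) (g x) y @[x --> F] --> trunc_kernel a s theta y.
Proof.
move=> a0 s0 fs gt.
have divs z : (z - g x) / f x @[x --> F] --> (z - theta) / s.
  by apply: cvgM; [apply: cvgB => //; exact: cvg_cst|apply: cvgV => //; rewrite gt_eqF].
have comp (h : R -> R) z : continuous h ->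
    h ((z - g x) / f x) @[x --> F] --> h ((z - theta) / s).
  by move=> ch; apply: continuous_cvg (divs z); exact: ch.
rewrite /trunc_kernel /trunc_const.
apply: cvgM; last exact: cvg_cst.
apply: cvgM; last exact/comp/continuous_std_normal_pdf.
apply: cvgM; last by apply: cvgV => //; rewrite gt_eqF.
apply: cvgV; first by rewrite gt_eqF// subr_gt0 std_normal_cdfB_gt0.
by apply: cvgB; apply/comp/continuous_std_normal_cdf.
Qed.

Lemma continuous_trunc_kernel_bandwidth a theta y s : 0 < a -> 0 < s ->
  {for s, continuous (fun t => trunc_kernel a t theta y)}.
Proof. by move=> a0 s0; apply: trunc_kernel_cvg => //; exact: cvg_cst. Qed.

Lemma measurable_trunc_kernel a s y : 0 < a -> 0 < s ->
  measurable_fun setT (fun theta => trunc_kernel a s theta y).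
Proof.
move=> a0 s0; apply: continuous_measurable_fun => theta.
by apply: trunc_kernel_cvg => //; exact: cvg_cst.
Qed.

End truncated_normal_kernel.

(** * Null sets of the Polya urn *)

Section escobar_west_support.
Context {R : realType}.
Variables (alpha : {posnum R}) (G0 : probability R R).

Lemma measurable_exists_tnth n (D : set R) : measurable D ->
  measurable [set t : n.-tuple R | exists i, D (tnth t i)].
Proof.
move=> mD.
rewrite (_ : [set _ | _] =
    \bigcup_(i in [set: 'I_n]) ((fun t : n.-tuple R => tnth t i) @^-1` D)).
  apply: fin_bigcup_measurable => // i _; rewrite -[X in measurable X]setTI.
  exact: measurable_tnth.
by apply/seteqP; split => t [i]; [exists i|exists i].
Qed.

(** By induction: a new location is either drawn from [G0], which misses [D], or copied from earlier
    locations, which almost surely avoid [D]. *)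
Lemma polya_urn_null n (D : set R) : measurable D -> G0 D = 0%E ->
  polya_urn alpha G0 n [set t | exists i, D (tnth t i)] = 0%E.
Proof.
move=> mD D0; elim: n => [|n IHn].
  rewrite (_ : [set t | _] = set0) ?measure0//.
  by apply/seteqP; split=> t // [[]].
rewrite /= /distribution /pushforward /kernel_product/=.
apply/eqP; rewrite eq_le integral_ge0// andbT.
pose N := [set t : n.-tuple R | exists i, D (tnth t i)].
(* Zero takes the shape of the bound in [integral_le_off], with [hi = 0], [C = 1] and an empty
   [E]. *)
rewrite (_ : 0%E = (0 + 1 * fine (polya_urn alpha G0 n set0))%:E); last first.
  by rewrite measure0 mulr0 addr0.
have mA t : measurable (xsection (tuple_rcons (m:=n) @^-1`
    [set t | exists i, D (tnth t i)]) t).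
  apply: measurable_xsection; rewrite -[X in measurable X]setTI.
  by apply: measurable_funP => //; exact: measurable_exists_tnth.
apply: (@integral_le_off _ _ _ _ _ _ N) => //.
- exact: measurable_exists_tnth.
- move=> t Nt _; rewrite polya_predictiveE.
  (* When no earlier location is in [D], only the appended one can be. *)
  have sub : xsection (tuple_rcons (m:=n) @^-1`
      [set t | exists i, D (tnth t i)]) t `<=` D.
    move=> x; rewrite /xsection/= inE => -[i].
    rewrite (tnth_nth 0)/= nth_rcons size_tuple.
    case: ltnP => [lt_in|]; last first.
      by rewrite leq_eqVlt ltnNge -ltnS ltn_ord orbF eq_sym => ->.
    by rewrite -[nth 0 t i]/(nth 0 t (Ordinal lt_in)) -tnth_nth => Dt; case: Nt; exists (Ordinal lt_in).
  rewrite (subset_measure0 (mA t) mD sub D0) mule0 add0e big1 ?mule0// => j _.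
  rewrite diracE memNset// => /sub Dt; apply: Nt; exists j.
  by rewrite (tnth_nth 0).
- move=> t _; apply: (@le_trans _ _ (polya_predictive alpha G0 t setT)).
    by rewrite le_measure ?inE.
  by rewrite prob_kernel.
Qed.

End escobar_west_support.

(** * Null sets of the prior and of the posterior *)

Section null_sets.
Context {R : realType}.

Lemma mnormalize_null d (T : measurableType d) (mu : {measure set T -> \bar R})
    (P : probability T R) (A : set T) :
  mu A = 0%E -> P A = 0%E -> mnormalize mu P A = 0%E.
Proof. by move=> muA PA; rewrite /mnormalize; case: ifP => // _; rewrite muA mul0e. Qed.

Lemma ew_prior_null (alpha : {posnum R}) (G0 Gs : probability R R) n
    (A : set (n.-tuple R)) (B : set R) : measurable A -> measurable B ->
  polya_urn alpha G0 n A = 0%E -> Gs B = 0%E ->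
  ew_prior alpha G0 Gs (n:=n) [set p | A p.1 \/ B p.2] = 0%E.
Proof.
move=> mA mB A0 B0.
rewrite (_ : [set _ | _] = (A `*` setT) `|` (setT `*` B)).
  apply: null_set_setU.
  - exact: measurableX.
  - exact: measurableX.
  - have E : (polya_urn alpha G0 n \x Gs)%E (A `*` setT) = 0%E.
      by rewrite product_measure1E// (_ : _ A = 0%E) ?mul0e.
    exact: E.
  - have E : (polya_urn alpha G0 n \x Gs)%E (setT `*` B) = 0%E.
      by rewrite product_measure1E// (_ : _ B = 0%E) ?mule0.
    exact: E.
by apply/seteqP; split=> p /=; tauto.
Qed.

(** The posterior has a density with respect to the prior, or is the prior itself when [mnormalize]
    falls back; both cases are absolutely continuous, whatever [Y] is. *)
Lemma ew_posterior_null (alpha : {posnum R}) (G0 Gs : probability R R) n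
    (Y : n.-tuple R) (N : set (n.-tuple R * R)) : measurable N ->
  ew_prior alpha G0 Gs (n:=n) N = 0%E -> ew_posterior alpha G0 Gs Y N = 0%E.
Proof.
move=> mN N0; apply: mnormalize_null => //.
apply: null_set_integral => //.
by apply/measurable_EFinP; apply: measurable_funTS; exact: measurable_ew_likelihood.
Qed.

(** Scaling fixes the origin, so [Gs] inherits from [G] the absence of mass on the nonpositive
    half-line; the other tail is null by assumption. *)
Lemma scaled_prior_concentrated (G Gs : probability R R) (s : R) : 0 < s ->
  G `]0, +oo[%classic = 1%E ->
  (forall t, Gs `]-oo, t]%classic = G `]-oo, t / s]%classic) ->
  Gs `]s, +oo[%classic = 0%E ->
  Gs (~` `]0, s]%classic) = 0%E.
Proof.
move=> s0 G1 Gst Gss.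
have Gs0 : Gs `]-oo, 0%R]%classic = 0%E.
  rewrite Gst mul0r -setCitvr.
  have GC := probability_setC G (measurable_itv `]0, +oo[).
  by rewrite G1 subee// in GC.
rewrite (_ : ~` _ = `]-oo, 0] `|` `]s, +oo[).
  exact: null_set_setU.
apply/seteqP; split => x /=; rewrite !in_itv/= ?andbT.
  by move=> /negP; rewrite negb_and -leNgt -ltNge => /orP.
by move=> xs; apply/negP; rewrite negb_and -leNgt -ltNge; apply/orP.
Qed.

End null_sets.

(** * The [G0] mixture of kernels as a function of the bandwidth *)

Section mixture_of_truncated_normals.
Context {R : realType}.
Variables (G0 : probability R R) (a M : R).
Hypothesis a_gt0 : 0 < a.
Hypothesis G0M : G0 [set x | M < `|x|] = 0%E.

(** This is the [G0] part of the estimator at total bandwidth [s]; for [|y| <= a], its value at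
    [s = k] is the limit sought. *)
Definition trunc_mixture (s y : R) : R := \int[G0]_theta trunc_kernel a s theta y.

Lemma integral_trunc_kernel_le eta s y : 0 < eta -> eta <= s ->
  (\int[G0]_theta (trunc_kernel a s theta y)%:E
    <= (trunc_kernel_bound a M eta)%:E)%E.
Proof.
move=> eta0 etas.
have B0 := trunc_kernel_bound_ge0 M eta (ltW a_gt0).
have := @integral_le_off _ _ _ G0 (fun x => (trunc_kernel a s x y)%:E)
  set0 _ _ _ measurable0 (measurable_norm_gt M) G0M B0 B0.
rewrite measure0 mulr0 addr0; apply.
- by move=> x; rewrite lee_fin trunc_kernel_ge0// ltW.
- move=> x /= /negP; rewrite -leNgt => xM _; rewrite lee_fin.
  exact: trunc_kernel_le.
- move=> x /= /negP; rewrite -leNgt => xM; rewrite lee_fin.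
  exact: trunc_kernel_le.
Qed.

Lemma trunc_mixtureE s y : 0 < s ->
  (\int[G0]_theta (trunc_kernel a s theta y)%:E = (trunc_mixture s y)%:E)%E.
Proof.
move=> s0; rewrite /trunc_mixture /Rintegral fineK//.
rewrite fin_numE; apply/andP; split.
  rewrite gt_eqF// (lt_le_trans ltNy0)// integral_ge0// => x _.
  by rewrite lee_fin trunc_kernel_ge0// ltW.
by rewrite lt_eqF// (le_lt_trans (integral_trunc_kernel_le y s0 (lexx _))) ?ltry.
Qed.

Lemma trunc_mixture_ge0 s y : 0 <= trunc_mixture s y.
Proof.
apply: fine_ge0; apply: integral_ge0 => x _.
by rewrite lee_fin trunc_kernel_ge0// ltW.
Qed.

Lemma trunc_mixture_le eta s y : 0 < eta -> eta <= s ->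
  trunc_mixture s y <= trunc_kernel_bound a M eta.
Proof.
move=> eta0 etas; rewrite -lee_fin -trunc_mixtureE.
  exact: integral_trunc_kernel_le.
exact: lt_le_trans etas.
Qed.

(** Dominated convergence over bandwidths in []s / 2, s + 1[]: staying above [s / 2] makes the
    kernel bound a constant dominating function for [G0]-almost every location. *)
Lemma continuous_trunc_mixture y s : 0 < s ->
  {for s, continuous (trunc_mixture ^~ y)}.
Proof.
move=> s0; have s20 : 0 < s / 2 by rewrite divr_gt0.
apply: (@continuity_under_integral R _ _ G0
  (fun t theta => trunc_kernel a t theta y) setT measurableT (s / 2) (s + 1)
  _ _ (cst (trunc_kernel_bound a M (s / 2)))) => //.
- move=> t /=; rewrite in_itv/= => /andP[st _].
  have t0 : 0 < t by exact: lt_trans st.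
  apply/integrableP; split.
    by apply/measurable_EFinP; exact: measurable_trunc_kernel.
  under eq_integral => x _.
    rewrite gee0_abs; last by rewrite lee_fin trunc_kernel_ge0// ltW.
    over.
  by rewrite (le_lt_trans (integral_trunc_kernel_le y t0 (lexx _))) ?ltry.
- apply: aeW => x _ t; rewrite inE/= in_itv/= => /andP[st _].
  by apply: continuous_trunc_kernel_bandwidth => //; exact: lt_trans st.
- exact: finite_measure_integrable_cst.
- move=> t /=; rewrite in_itv/= => /andP[st _].
  exists [set x | M < `|x|]; split => //; first exact: measurable_norm_gt.
  move=> x /=; apply: contra_notP => /negP; rewrite -leNgt => xM _.
  rewrite ger0_norm ?trunc_kernel_ge0 ?(ltW a_gt0)//.
  by apply: trunc_kernel_le => //; exact: ltW.
- by rewrite inE/= in_itv/= ltrDl ltr01 andbT gtr_pMr// invf_lt1// ltr1n.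
Qed.

End mixture_of_truncated_normals.

(** * Bounds on the posterior mean for fixed data *)

Section posterior_mean.
Context {R : realType}.
Variables (alpha : {posnum R}) (G0 : probability R R) (a M eta : R).
Hypotheses (a_gt0 : 0 < a) (eta_gt0 : 0 < eta).
Hypothesis G0M : G0 [set x | M < `|x|] = 0%E.

Definition prior_weight (n : nat) : R := alpha%:num / (alpha%:num + n%:R).

(** This form exposes the ratio [n / alpha], whose limit governs the weight. *)
Lemma prior_weightE n : prior_weight n = (1 + n%:R / alpha%:num)^-1.
Proof.
rewrite /prior_weight -[X in (X + n%:R / _)^-1](@divff _ alpha%:num)//.
by rewrite -mulrDl invf_div.
Qed.

Lemma prior_weightC n : n%:R / (alpha%:num + n%:R) = 1 - prior_weight n.
Proof. by rewrite /prior_weight; field. Qed.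

Lemma ew_density_ge0 n h y (p : n.-tuple R * R) :
  0 <= ew_density alpha G0 a h y p.
Proof.
rewrite /ew_density addr_ge0// mulr_ge0//; first exact: trunc_mixture_ge0.
by apply: sumr_ge0 => i _; rewrite trunc_kernel_ge0// ltW.
Qed.

(** The urn sum has [n] terms between 0 and the kernel bound, and [n / (alpha + n)] is the
    complement of the prior weight. *)
Lemma ew_density_bounds n h y (p : n.-tuple R * R) :
  eta <= p.2 + h -> (forall i, `|tnth p.1 i| <= M) ->
  prior_weight n * trunc_mixture G0 a (p.2 + h) y
    <= ew_density alpha G0 a h y p
    <= prior_weight n * trunc_mixture G0 a (p.2 + h) y +
       (1 - prior_weight n) * trunc_kernel_bound a M eta.
Proof.
move=> etas thM; rewrite /ew_density lerDl lerD2l; apply/andP; split.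
  rewrite mulr_ge0//.
  by apply: sumr_ge0 => i _; rewrite trunc_kernel_ge0// ltW.
rewrite -prior_weightC mulrAC [in leRHS]mulrC ler_wpM2l//.
rewrite mulr_natl -[X in _ *+ X]card_ord -sumr_const.
by apply: ler_sum => i _; exact: trunc_kernel_le.
Qed.

(** Outside a posterior null set, all locations are at most [M] in modulus and [sigma] is in []0,
    tau]], so the bandwidth [sigma + h] is in []h, tau + h]]. The pointwise bounds there pass to the
    mean. *)
Lemma posterior_mean_bounds n (Gs : probability R R) (tau lo hi h y : R)
    (Yn : n.-tuple R) :
  Gs (~` `]0, tau]%classic) = 0%E -> eta <= h ->
  (forall s, h < s <= tau + h -> lo <= trunc_mixture G0 a s y <= hi) ->
  0 <= hi ->
  ((prior_weight n * lo)%:E <=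
    'E_(ew_posterior alpha G0 Gs Yn)[ew_density alpha G0 a h y] <=
    (prior_weight n * hi +
     (1 - prior_weight n) * trunc_kernel_bound a M eta)%:E)%E.
Proof.
move=> Gs0 etah lohi hi0.
pose A := [set t : n.-tuple R | exists i, M < `|tnth t i|].
pose B := ~` `]0, tau]%classic : set R.
pose N := [set p : n.-tuple R * R | A p.1 \/ B p.2].
have mA : measurable A by exact: (measurable_exists_tnth (measurable_norm_gt M)).
have mB : measurable B by exact: measurableC.
have mN : measurable N.
  rewrite (_ : N = (A `*` setT) `|` (setT `*` B)).
    by apply: measurableU; exact: measurableX.
  by apply/seteqP; split=> p; rewrite /N/=; tauto.
have PN : ew_posterior alpha G0 Gs Yn N = 0%E.
  apply: ew_posterior_null => //; apply: ew_prior_null => //.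
  by exact: (polya_urn_null _ _ (measurable_norm_gt M)).
have w0 : 0 <= prior_weight n by rewrite /prior_weight.
have w1 : 0 <= 1 - prior_weight n by rewrite -prior_weightC.
have bnd p : ~ N p ->
    prior_weight n * lo <= ew_density alpha G0 a h y p <=
    prior_weight n * hi + (1 - prior_weight n) * trunc_kernel_bound a M eta.
  move=> /not_orP[nA /contrapT]; rewrite /= in_itv/= => /andP[p0 pt].
  have etas : eta <= p.2 + h by rewrite (le_trans etah)// lerDr ltW.
  have thM i : `|tnth p.1 i| <= M.
    by rewrite leNgt; apply/negP => Mi; apply: nA; exists i.
  have /andP[l u] := ew_density_bounds y etas thM.
  have /lohi/andP[lo_le le_hi] : h < p.2 + h <= tau + h.
    by rewrite ltrDr p0 lerD2r.
  rewrite (le_trans _ l) ?ler_wpM2l//= (le_trans u)// lerD2r.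
  by rewrite ler_wpM2l.
rewrite expectation.unlock; apply/andP; split.
  have := @integral_ge_off _ _ _ (ew_posterior alpha G0 Gs Yn)
    (fun p => (ew_density alpha G0 a h y p)%:E) N (prior_weight n * lo) mN.
  rewrite PN subr0 mulr1; apply => p; first by rewrite lee_fin ew_density_ge0.
  by rewrite lee_fin => /bnd/andP[].
have hi'0 : 0 <= prior_weight n * hi +
    (1 - prior_weight n) * trunc_kernel_bound a M eta.
  apply: addr_ge0; apply: mulr_ge0 => //.
  exact: trunc_kernel_bound_ge0 (ltW a_gt0).
have := @integral_le_off _ _ _ (ew_posterior alpha G0 Gs Yn)
  (fun p => (ew_density alpha G0 a h y p)%:E) set0 N _ _
  measurable0 mN PN hi'0 hi'0.
rewrite measure0 mulr0 addr0; apply => p.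
- by rewrite lee_fin ew_density_ge0.
- by rewrite lee_fin => /bnd/andP[].
- by rewrite lee_fin => /bnd/andP[].
Qed.

End posterior_mean.

(** * Limits and convergence in probability *)

Section limits.
Context {R : realType}.

Lemma cst_bigO_cvg0 (r : R) (e : nat -> R) :
  (fun=> r) =O_\oo e -> e n @[n --> \oo] --> (0 : R) -> r = 0.
Proof.
move=> /eqO_exP[K [K0 rK]] e0; apply/eqP; rewrite -normr_le0.
apply/ler_addgt0Pr => d d0; rewrite add0r.
have dK : 0 < d / K by rewrite divr_gt0.
near \oo => n.
have rn : `|r| <= K * `|e n| by near: n; exact: rK.
apply: (le_trans rn); rewrite -ler_pdivlMl// mulrC.
near: n; move/cvgrPdist_le : e0 => /(_ _ dK).
by apply: filterS => n; rewrite sub0r normrN.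
Unshelve. all: by end_near. Qed.

Lemma squeeze_eps_cvge (u : nat -> \bar R) (l : R) :
  (forall e, 0 < e -> \forall n \near \oo, ((l - e)%:E <= u n <= (l + e)%:E)%E) ->
  u n @[n --> \oo] --> l%:E.
Proof.
move=> H; apply/fine_cvgP; split.
  have := H _ ltr01; apply: filterS => n /andP[]; rewrite fin_numE.
  by case: (u n).
apply/cvgrPdist_le => e e0; have := H _ e0; apply: filterS => n /=.
case: (u n) => [r| |]//=; rewrite ?leye_eq ?leeNy_eq ?andbF// !lee_fin.
by rewrite ler_distlC.
Qed.

(** The indicators of the deviation events tend to 0 almost everywhere and are dominated by 1, so
    their integrals tend to 0. *)
Lemma ae_cvg_cvg_probability d (T : measurableType d) (P : probability T R)
    (X : nat -> T -> R) (l r : R) : 0 < r ->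
  (forall n, measurable_fun setT (X n)) ->
  {ae P, forall w, X n w @[n --> \oo] --> l} ->
  fine (P [set w | r <= `|X n w - l|]) @[n --> \oo] --> (0 : R).
Proof.
move=> r0 mX cX; pose E n := [set w | r <= `|X n w - l|].
have mE n : measurable (E n).
  rewrite -[X in measurable X]setTI; apply: measurable_fun_le => //.
  apply: measurableT_comp => //; exact: measurable_funB.
have ind0 : {ae P, forall w, setT w ->
    (\1_(E n) w)%:E @[n --> \oo] --> cst (0 : \bar R) w}.
  apply: filterS cX => w Xl _; apply: cvg_near_cst.
  move/cvgrPdist_lt : Xl => /(_ _ r0); apply: filterS => n Xn.
  by rewrite indicE memNset//= /E/=; apply/negP; rewrite -ltNge distrC.
have ind1 : {ae P, forall w n, setT w ->
    (`|(\1_(E n) w)%:E| <= cst (1 : \bar R) w)%E}.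
  by apply: aeW => w n _; rewrite gee0_abs lee_fin// indicE lern1 leq_b1.
have [_ _] := @dominated_convergence _ _ _ P setT measurableT
  (fun n w => (\1_(E n) w)%:E) (cst 0%E) (cst 1%E)
  (fun n => (measurable_EFinP _ _).2 (measurable_indic (mE n)))
  (measurable_cst _) ind0 (finite_measure_integrable_cst P 1 measurableT) ind1.
rewrite integral0 => /fine_cvgP[_].
apply: cvg_trans; apply: near_eq_cvg; near=> n => /=.
by rewrite integral_indic// setIT.
Unshelve. all: by end_near. Qed.

End limits.

(** * The sample map, the limiting integrand, and the limit of the expected estimate *)

Lemma measurable_sample (R : realType) d (T : measurableType d)
    (P : probability T R) (Y : forall n : nat, 'I_n -> {RV P >-> R}) n :
  measurable_fun setT (sample Y n).
Proof.
apply/measurable_fun_tnthP => i.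
rewrite (_ : _ \o _ = Y n i); first exact: measurable_funP.
by apply/funext => w /=; rewrite tnth_mktuple.
Qed.

Lemma truncated_normal_pdfE (R : realType) (a k theta y : R) : 0 < k -> `|y| <= a ->
  trunc_const a theta k / (k * Num.sqrt (2 * pi)) *
    expR (- ((y - theta) ^+ 2 / (2 * k ^+ 2))) = trunc_kernel a k theta y.
Proof.
move=> k0 ya; rewrite /trunc_kernel ya mulr1 std_normal_pdfE /normal_peak.
rewrite [in RHS]mulrA; congr (_ * expR (- _)).
  by rewrite expr1n mul1r -(mulr_natl pi 2) invfM mulrA.
by field; rewrite gt_eqF.
Qed.

Theorem theorem9p1 (R : realType) (a c k : R)
  (a_gt0 : 0 < a) (c_gt0 : 0 < c) (k_gt0 : 0 < k)
  (* true density and data *)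
  (F0 : probability R R)
  (F0_supported : F0 `[(- a - c), (a + c)]%classic = 1%E)
  (d : measure_display) (Omega : measurableType d) (P0 : probability Omega R)
  (Y : forall n : nat, 'I_n -> {RV P0 >-> R})
  (Y_independent : forall n, mutually_independent (Y n))
  (Y_density : forall n i, has_density (Y n i) (true_density a c k F0))
  (* bandwidth estimator *)
  (khat : forall n : nat, n.-tuple R -> R)
  (khat_measurable : forall n, measurable_fun setT (khat n))
  (khat_cvg : {ae P0, forall w,
     khat n (sample Y n w) @[n --> \oo] --> k})
  (eta : R) (eta_gt0 : 0 < eta)
  (khat_gt : {ae P0, forall w, forall n, (1 <= n)%N ->
     eta < khat n (sample Y n w)})
  (khat_ui : uniformly_integrable P0
     (fun m w => (khat m.+1 (sample Y m.+1 w) - k) ^+ 2))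
  (* priors *)
  (G0 : probability R R)
  (G0_compact_support : compact (topological_support G0))
  (G0_support : `[(- a - c), (a + c)]%classic `|` `[(- (2 * a)), (2 * a)]%classic
     `<=` topological_support G0)
  (alpha : nat -> {posnum R})
  (G : probability R R) (G_positive : G `]0, +oo[%classic = 1%E)
  (sigma : nat -> R) (sigma_gt0 : forall n, 0 < sigma n)
  (sigma_cvg : sigma n @[n --> \oo] --> (0 : R))
  (Gn : nat -> probability R R)
  (Gn_cdf : forall n s, Gn n `]-oo, s]%classic = G `]-oo, s / sigma n]%classic)
  (eps : nat -> R) (eps_itv : forall n, 0 < eps n < 1)
  (eps_cvg : eps n @[n --> \oo] --> (0 : R))
  (Gn_tail : (fun n => fine (Gn n `]sigma n, +oo[%classic)) =O_\oo eps)
  (b : nat -> R) (b_itv : forall n, 0 < b n < sigma n)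
  (b_ratio : sigma n / b n @[n --> \oo] --> (1 : R))
  (Gn_b_gt0 : forall n, (0 < Gn n `]b n, sigma n]%classic)%E)
  (Gn_ratio : (fun n => fine (Gn n `]sigma n, +oo[%classic) /
                        fine (Gn n `]b n, sigma n]%classic))
     =O_\oo (fun n => eps n / (1 - eps n)))
  (* growth of the precision parameter *)
  (alpha_fast : n%:R / (alpha n)%:num @[n --> \oo] --> (0 : R)) :
  forall y : R, `|y| <= a ->
    (\int[P0]_w
       'E_(ew_posterior (alpha n) G0 (Gn n) (sample Y n w))
         [ew_density (alpha n) G0 a (khat n (sample Y n w)) y])%E
      @[n --> \oo] -->
    (\int[G0]_theta
       (trunc_const a theta k / (k * Num.sqrt (2 * pi)) *
        expR (- ((y - theta) ^+ 2 / (2 * k ^+ 2))))%:E)%E.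
Proof.
move=> y ya.
have [M G0M] := compact_support_bounded G0_compact_support.
(* [eta1] lies below both the estimated bandwidth and [k], so one constant [C] bounds the mixture at
   either. *)
pose eta1 := Num.min eta (k / 2).
have eta1_gt0 : 0 < eta1 by rewrite lt_min eta_gt0 divr_gt0.
have eta1_k : eta1 <= k by rewrite ge_min; apply/orP; right; lra.
pose C := trunc_kernel_bound a M eta1.
have C_ge0 : 0 <= C by exact: trunc_kernel_bound_ge0 (ltW a_gt0).
pose g s := trunc_mixture G0 a s y.
have g_bnd s : eta1 <= s -> 0 <= g s <= C.
  by move=> es; rewrite trunc_mixture_ge0//= (trunc_mixture_le a_gt0 G0M y eta1_gt0 es).
have -> : (\int[G0]_theta
    (trunc_const a theta k / (k * Num.sqrt (2 * pi)) *
     expR (- ((y - theta) ^+ 2 / (2 * k ^+ 2))))%:E = (g k)%:E)%E.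
  rewrite -(trunc_mixtureE a_gt0 G0M y k_gt0).
  by apply: eq_integral => theta _; rewrite (truncated_normal_pdfE theta k_gt0 ya).
(* [sigma] has a scale family as prior, so the prior mass beyond [sigma n] does
   not depend on [n]; being [O(eps n)], it vanishes. *)
have Gn_tail0 n : Gn n `]sigma n, +oo[%classic = 0%E.
  have tailE m : Gn m `]sigma m, +oo[%classic = (1 - G `]-oo, 1%R]%classic)%E.
    rewrite -setCitvl (_ : _ (~` _) = 1 - Gn m `]-oo, (sigma m)%R]%classic)%E.
      by rewrite Gn_cdf divff// gt_eqF.
    exact: probability_setC.
  have /cst_bigO_cvg0 : (fun=> fine (1 - G `]-oo, 1%R]%classic)%E) =O_\oo eps.
    rewrite (_ : (fun=> _) = (fun m => fine (Gn m `]sigma m, +oo[%classic)))//.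
    by apply/funext => m; rewrite tailE.
  move=> /(_ eps_cvg) tail0.
  rewrite -[LHS]fineK; last exact: fin_num_measure.
  by rewrite tailE tail0.
have Gn_conc n : Gn n (~` `]0, sigma n]%classic) = 0%E.
  exact: (scaled_prior_concentrated (sigma_gt0 n) G_positive (Gn_cdf n) (Gn_tail0 n)).
pose X n w := khat n (sample Y n w).
have mX n : measurable_fun setT (X n).
  exact: (measurableT_comp (khat_measurable n) (@measurable_sample _ _ _ _ Y n)).
have [N [mN N0 khatN]] := khat_gt.
have khatN' w : ~ N w -> forall n, (1 <= n)%N -> eta1 <= X n w.
  move=> nNw n n1; apply: (@le_trans _ _ eta); first by rewrite ge_min lexx.
  by apply: ltW; move: n n1; apply: contrapT => /khatN.
apply: squeeze_eps_cvge => e e_gt0.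
(* Half of [e] covers the variation of the mixture near [k], the other half the convergence of
   [lower] and [upper]. *)
pose del := e / 2.
have del_gt0 : 0 < del by rewrite divr_gt0.
have /cvgrPdist_le/(_ _ del_gt0)/nbhs_ballP[r /= r_gt0 g_near] :=
  @continuous_trunc_mixture R G0 a M a_gt0 G0M y k k_gt0.
(* The distance from the total bandwidth to [k] is split into the error of the estimator, below
   [r / 2] off [E n], and [sigma n], eventually at most [r / 2]. *)
pose r2 := r / 2.
have r2_gt0 : 0 < r2 by rewrite divr_gt0.
pose E n := [set w | r2 <= `|X n w - k|].
have mE n : measurable (E n).
  rewrite -[X in measurable X]setTI; apply: measurable_fun_le => //.
  by apply: measurableT_comp => //; exact: measurable_funB.
pose p n := fine (P0 (E n)).
have p0 : p n @[n --> \oo] --> (0 : R).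
  exact: ae_cvg_cvg_probability.
pose q n := prior_weight (alpha n) n.
have q1 : q n @[n --> \oo] --> (1 : R).
  rewrite /q; under eq_fun do rewrite prior_weightE.
  have : (1 + n%:R / (alpha n)%:num)^-1 @[n --> \oo] --> (1 + 0 : R)^-1.
    apply: cvgV; first by rewrite addr0 oner_eq0.
    by apply: cvgD => //; exact: cvg_cst.
  by rewrite addr0 invr1.
(* The lower bound discards the event [E n]; the upper one pays at most [C] on it. *)
pose lower n := q n * (g k - del) * (1 - p n).
pose upper n := q n * (g k + del) + (1 - q n) * C + C * p n.
have lower_cvg : lower n @[n --> \oo] --> g k - del.
  have -> : g k - del = 1 * (g k - del) * (1 - 0) by ring.
  apply: cvgM; first by apply: cvgM => //; exact: cvg_cst.
  by apply: cvgB => //; exact: cvg_cst.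
have upper_cvg : upper n @[n --> \oo] --> g k + del.
  have -> : g k + del = 1 * (g k + del) + (1 - 1) * C + C * 0 by ring.
  apply: cvgD; last by apply: cvgM => //; exact: cvg_cst.
  apply: cvgD; first by apply: cvgM => //; exact: cvg_cst.
  by apply: cvgM; [apply: cvgB => //; exact: cvg_cst|exact: cvg_cst].
near=> n.
have n_gt0 : (1 <= n)%N by near: n; exists 1%N.
have sigma_r2 : sigma n <= r2.
  near: n; move/cvgrPdist_le : sigma_cvg => /(_ _ r2_gt0).
  by apply: filterS => n; rewrite sub0r normrN; apply: le_trans; exact: ler_norm.
pose I w := ('E_(ew_posterior (alpha n) G0 (Gn n) (sample Y n w))
  [ew_density (alpha n) G0 a (X n w) y])%E.
have I_ge0 w : (0 <= I w)%E.
  rewrite /I expectation.unlock integral_ge0// => t _.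
  by rewrite lee_fin ew_density_ge0.
(* With [hi = C] the two weights recombine: [q n * C + (1 - q n) * C = C]. *)
have I_le w : ~ N w -> (I w <= C%:E)%E.
  move=> nNw.
  have /andP[_] := @posterior_mean_bounds _ (alpha n) G0 a M eta1 a_gt0
    eta1_gt0 G0M n (Gn n) (sigma n) 0 C (X n w) y (sample Y n w)
    (Gn_conc n) (khatN' w nNw n n_gt0)
    (fun s Xs => g_bnd s (le_trans (khatN' w nNw n n_gt0) (ltW (proj1 (andP Xs)))))
    C_ge0.
  by rewrite -mulrDl addrC subrK mul1r.
have I_near w : ~ N w -> ~ E n w ->
    ((q n * (g k - del))%:E <= I w <= (q n * (g k + del) + (1 - q n) * C)%:E)%E.
  move=> nNw /negP; rewrite -ltNge => Xk.
  apply: posterior_mean_bounds => //; first exact: khatN'.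
    move=> s /andP[Xs sX]; rewrite -ler_distlC; apply: g_near.
    rewrite /ball/=; move: Xk; rewrite !ltr_norml /r2 => /andP[].
    rewrite /r2 in sigma_r2.
    by move=> *; apply/andP; split; lra.
  by rewrite addr_ge0// ?(ltW del_gt0)//; have /andP[] := g_bnd k eta1_k.
have q_itv : 0 <= q n <= 1.
  by rewrite /q {1}/prior_weight divr_ge0//= -subr_ge0 -prior_weightC divr_ge0.
have [q_ge0 q_le1] := andP q_itv.
have [gk_ge0 gk_le] := andP (g_bnd k eta1_k).
apply/andP; split.
- apply: (@le_trans _ _ (lower n)%:E).
    rewrite lee_fin; near: n.
    apply: (cvgr_ge (g k - del)) => //.
    by rewrite /del; lra.
  (* [integral_ge_off] allows a single exceptional set, so the null set [N] is merged into [E n] at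
     no cost in probability. *)
  rewrite /lower /p -(_ : P0 (E n `|` N) = P0 (E n)); last exact: measureU0.
  apply: integral_ge_off => //; first exact: measurableU.
  by move=> w /not_orP[nE nN]; have /andP[] := I_near w nN nE.
- apply: (@le_trans _ _ (upper n)%:E).
    apply: (@integral_le_off _ _ _ P0 I (E n) N) => //.
    + rewrite addr_ge0// mulr_ge0// ?subr_ge0//.
      by rewrite addr_ge0// ltW.
    + by move=> w nN nE; have /andP[] := I_near w nN nE.
  rewrite lee_fin; near: n.
  apply: (cvgr_le (g k + del)) => //.
  by rewrite /del; lra.
Unshelve. all: by end_near. Qed.
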